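(* Let $R$ be a Noetherian ring, $I$ an ideal of $R$, and $M$ a finitely generated $R$-module. Then $$\mathrm{Ass}_R(M/I^n M) = \mathrm{Ass}_R(0:_M I) \cup \mathrm{Ass}_R(I^{n-1} M/I^{n} M) \quad \text{for all } n \gg 0.$$ In particular, $\mathcal{A}_M(I) = \mathrm{Ass}_R(0:_M I) \cup \mathcal{B}_M(I)$.
   Context: Rings are commutative. $(0:_M I) := \{x \in M : Ix = 0\}$. It is known that the sets $\mathrm{Ass}_R(M/I^nM)$ and $\mathrm{Ass}_R(I^{n-1}M/I^nM)$ are independent of $n$ for all sufficiently large $n$; their stable values are denoted $\mathcal{A}_M(I)$ and $\mathcal{B}_M(I)$, respectively. ''For all $n\gg 0$'' means for all sufficiently large integers $n$. *)

(* Defs.v *)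
From HB Require Import structures.
From mathcomp Require Import all_boot all_order all_algebra.
From mathcomp Require Import mathcomp_extra boolp classical_sets.

Set Implicit Arguments.
Unset Strict Implicit.
Unset Printing Implicit Defensive.

Import GRing.Theory.
Local Open Scope ring_scope.
Local Open Scope classical_set_scope.
Local Open Scope quotient_scope.

(* Rings are comPzRingTypes, so that the zero ring is allowed; this rules out
   prime_idealr, which is only available over nzRingTypes. *)

Notation submodule M := (GRing.SubmodClosed.type M).
Notation ideal R := (GRing.SubmodClosed.type (R : comPzRingType)^o).

Section Submodules.
Variables (R : comPzRingType) (M : lmodType R).

Definition full_pred : {pred M} := predT.

Lemma full_closed : submod_closed full_pred.
Proof. by split. Qed.

HB.instance Definition _ :=
  GRing.isSubmodClosed.Build R M full_pred full_closed.

Definition full : submodule M := full_pred.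

Definition fin_gen (N : submodule M) : Prop :=
  exists (n : nat) (g : 'I_n -> M),
    forall x : M, x \in N <-> exists c : 'I_n -> R, x = \sum_i c i *: g i.

Definition smul_pred (I : ideal R) (N : submodule M) : {pred M} :=
  [pred x | `[< exists (n : nat) (a : 'I_n -> R) (y : 'I_n -> M),
    [/\ forall i, a i \in I, forall i, y i \in N
      & x = \sum_i a i *: y i] >]].

Lemma smul_closed I N : submod_closed (smul_pred I N).
Proof.
split; first by apply/asboolP; exists 0%N, (fun=> 0), (fun=> 0);
  split=> [[]//|[]//|]; rewrite big_ord0.
move=> r u v /asboolP[n [a [y [aI yN ->]]]] /asboolP[m [b [z [bI zN ->]]]].
apply/asboolP; exists (n + m)%N.
exists (fun i => match split i with inl j => a j | inr j => b j end).
exists (fun i => match split i with inl j => r *: y j | inr j => z j end).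
split=> [i|i|]; try by case: (split i) => j //; rewrite rpredZ.
rewrite big_split_ord scaler_sumr; congr (_ + _); apply: eq_bigr => i _.
  by rewrite (unsplitK (inl i)) !scalerA mulrC.
by rewrite (unsplitK (inr i)).
Qed.

HB.instance Definition _ I N :=
  GRing.isSubmodClosed.Build R M (smul_pred I N) (smul_closed I N).

(* The product I N: finite sums of products a y with a in I and y in N. *)
Definition smul (I : ideal R) (N : submodule M) : submodule M := smul_pred I N.

Definition annih_pred (I : ideal R) : {pred M} :=
  [pred x | `[< forall a, a \in I -> a *: x = 0 >]].

Lemma annih_closed I : submod_closed (annih_pred I).
Proof.
split; first by apply/asboolP => a _; rewrite scaler0.
move=> r u v /asboolP uP /asboolP vP; apply/asboolP => a aI.
by rewrite scalerDr scalerA mulrC -scalerA uP // vP // scaler0 addr0.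
Qed.

HB.instance Definition _ I :=
  GRing.isSubmodClosed.Build R M (annih_pred I) (annih_closed I).

(* (0 :_M I) *)
Definition annih_submod (I : ideal R) : submodule M := annih_pred I.

Definition ann_pred (x : M) : {pred R^o} := [pred r : R^o | (r : R) *: x == 0].

Lemma ann_closed x : submod_closed (ann_pred x).
Proof.
split; first by rewrite inE scale0r.
move=> r u v; rewrite !inE => /eqP ux /eqP vx.
by rewrite scalerDl -[r *: u]/((r : R) * u) -scalerA ux vx scaler0 addr0.
Qed.

HB.instance Definition _ x :=
  GRing.isSubmodClosed.Build R R^o (ann_pred x) (ann_closed x).

Definition ann (x : M) : ideal R := ann_pred x.

End Submodules.

Arguments full {R} M.
Arguments annih_submod {R} M I.

Section SubmoduleAsModule.
Variables (R : comPzRingType) (M : lmodType R) (N : submodule M).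

Definition submod : Type := {x : M | x \in N}.

HB.instance Definition _ := SubChoice.on submod.
HB.instance Definition _ := [SubChoice_isSubLmodule of submod by <:].

End SubmoduleAsModule.

Section QuotientModule.
Variables (R : comPzRingType) (M : lmodType R) (N : submodule M).

Lemma submodule_oppr : oppr_closed N.
Proof. by move=> x xN; rewrite -scaleN1r rpredZ. Qed.

(* SubmodClosed does not inherit from ZmodClosed, since it is defined over
   semimodules; this provides the zmodClosed needed by Quotient.quot. *)
Definition submodule_zmod : zmodClosed M :=
  HB.pack_for (zmodClosed M) (GRing.SubmodClosed.sort N)
    (GRing.isOppClosed.Build M (GRing.SubmodClosed.sort N) submodule_oppr).

Definition quotmod : Type := Quotient.quot submodule_zmod.

HB.instance Definition _ := GRing.Zmodule.on quotmod.
HB.instance Definition _ := EqQuotient.on quotmod.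

Definition quotmod_scale (r : R) (q : quotmod) : quotmod :=
  \pi_quotmod (r *: repr q).

Lemma quotmod_eqP (x y : M) :
  reflect (\pi_quotmod x = \pi_quotmod y) (x - y \in N).
Proof.
have -> : (x - y \in N) = (x == y %[mod (Quotient.quot submodule_zmod)]).
  by rewrite -Quotient.idealrBE.
exact: eqP.
Qed.

Lemma quotmod_piD : {morph \pi_quotmod : x y / x + y}.
Proof. exact: (raddfD \pi_(Quotient.quot submodule_zmod)). Qed.

Lemma quotmod_pi0 : \pi_quotmod 0 = 0.
Proof. exact: (raddf0 \pi_(Quotient.quot submodule_zmod)). Qed.

Lemma quotmod_piZ r x : quotmod_scale r (\pi_quotmod x) = \pi_quotmod (r *: x).
Proof.
apply/quotmod_eqP; rewrite -scalerBr rpredZ //.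
by apply/quotmod_eqP; rewrite reprK.
Qed.

Lemma quotmod_scaleA a b v :
  quotmod_scale a (quotmod_scale b v) = quotmod_scale (a * b) v.
Proof.
rewrite -[v]reprK (quotmod_piZ b) (quotmod_piZ a) (quotmod_piZ (a * b)).
by rewrite scalerA.
Qed.

Lemma quotmod_scale1 : left_id 1 quotmod_scale.
Proof. by move=> v; rewrite -[v]reprK quotmod_piZ scale1r. Qed.

Lemma quotmod_scaleDr : right_distributive quotmod_scale +%R.
Proof.
move=> a u v; rewrite -[u]reprK -[v]reprK -quotmod_piD !quotmod_piZ.
by rewrite scalerDr quotmod_piD.
Qed.

Lemma quotmod_scaleDl v : {morph quotmod_scale^~ v : a b / a + b}.
Proof.
move=> a b /=; rewrite -[v]reprK !quotmod_piZ.
by rewrite scalerDl quotmod_piD.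
Qed.

HB.instance Definition _ := GRing.Zmodule_isLmodule.Build R quotmod
  quotmod_scaleA quotmod_scale1 quotmod_scaleDr quotmod_scaleDl.

End QuotientModule.

Section Subquotient.
Variables (R : comPzRingType) (M : lmodType R) (N' N : submodule M).

Definition trace_pred : {pred submod N'} := [pred x | val x \in N].

Lemma trace_closed : submod_closed trace_pred.
Proof.
split; first by rewrite inE raddf0 rpred0.
by move=> r u v; rewrite !inE linearP => uN vN; rewrite rpredD // rpredZ.
Qed.

HB.instance Definition _ :=
  GRing.isSubmodClosed.Build R (submod N') trace_pred trace_closed.

(* N :&: N' viewed as a submodule of the module N'; this is N itself when N is
   contained in N'. *)
Definition trace_submod : submodule (submod N') := trace_pred.

(* The quotient N' / N, for N contained in N'. *)
Definition subquot : lmodType R := quotmod trace_submod.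

End Subquotient.

Section AssociatedPrimes.
Variable R : comPzRingType.

Definition noetherian : Prop := forall J : ideal R, fin_gen J.

Definition prime_ideal (P : ideal R) : Prop :=
  (1 : R) \notin P /\
  forall a b : R, a * b \in P -> a \in P \/ b \in P.

(* Ideals are compared as plain sets of ring elements, so that equality of sets
   of primes is Leibniz equality. *)
Definition Ass (M : lmodType R) : set (set R) :=
  [set P | exists x : M, prime_ideal (ann x) /\ P = [set r : R | r \in ann x]].

Definition ideal_exp (I : ideal R) (n : nat) : ideal R :=
  iter n (smul I) (full R^o).

(* I^n M *)
Definition ipow (I : ideal R) (M : lmodType R) (n : nat) : submodule M :=
  smul (ideal_exp I n) (full M).

Definition for_large (P : nat -> Prop) : Prop :=
  exists n0 : nat, forall n : nat, (n0 <= n)%N -> P n.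

(* The value taken by F n for all large n (unique when it exists). *)
Definition stable_value (T : Type) (F : nat -> set T) : set T :=
  xget set0 [set A | for_large (fun n => F n = A)].

Lemma stable_valueE (T : Type) (F : nat -> set T) (A : set T) :
  for_large (fun n => F n = A) -> stable_value F = A.
Proof.
move=> FA; apply: xget_unique => // B [m Bm]; case: FA => n An.
by rewrite -(Bm _ (leq_maxl m n)) (An _ (leq_maxr m n)).
Qed.

Definition Astable (I : ideal R) (M : lmodType R) : set (set R) :=
  stable_value (fun n => Ass (quotmod (ipow I M n))).

(* The index n = 0, where n.-1 = 0, is irrelevant to the stable value. *)
Definition Bstable (I : ideal R) (M : lmodType R) : set (set R) :=
  stable_value (fun n => Ass (subquot (ipow I M n.-1) (ipow I M n))).

End AssociatedPrimes.

(* Main.v *)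
(* Write R[It] for the Rees ring of I. Finitely generated graded R[It]-modules
   are Noetherian, by Hilbert's basis theorem. For n large this gives
   (0 :_M I) meets I^n M trivially, and, by Artin-Rees together with the vanishing
   in high degrees of the elements of (+) I^n M / I^(n+1) M killed by I,
   (I^n M :_M I) = I^(n-1) M + (0 :_M I).
   A prime P = ann x associated to M / I^n M contains I, so x comes from
   (I^n M :_M I), which modulo I^n M is the direct sum of (0 :_M I) and
   I^(n-1) M / I^n M; hence P is the intersection of the annihilators of the two
   components of x and, being prime, equals one of them. Both sides stabilize
   because Ass (I^n M / I^(n+1) M) is eventually increasing and all these sets
   lie in a common finite set. *)

Require Import Defs.
From HB Require Import structures.
From mathcomp Require Import all_boot all_order all_algebra.
From mathcomp Require Import mathcomp_extra boolp classical_sets.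

Set Implicit Arguments.
Unset Strict Implicit.
Unset Printing Implicit Defensive.

Import GRing.Theory.
Local Open Scope ring_scope.
Local Open Scope classical_set_scope.

(** * Uniform bounds and maximal elements *)

Lemma bounded_uniform (Q : nat -> nat -> Prop) (m : nat) :
  (forall e, (e < m)%N -> exists d0, forall d, (d0 <= d)%N -> Q e d) ->
  exists d0, forall d e, (d0 <= d)%N -> (e < m)%N -> Q e d.
Proof.
elim: m => [|m IH] QP; first by exists 0%N.
have [d1 d1P] := IH (fun e em => QP e (ltnW em)).
have [d2 d2P] := QP m (leqnn _).
exists (maxn d1 d2) => d e; rewrite geq_max => /andP[d1d d2d].
by rewrite ltnS leq_eqVlt => /predU1P[->|em]; [apply: d2P | apply: d1P].
Qed.

(** Otherwise choice gives a successor map on [ok] elements, and iterating it from [t0] produces a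
    forbidden chain. *)
Lemma exists_maximal (T : Type) (ok : T -> Prop) (lt : T -> T -> Prop) (t0 : T) :
  (forall u : nat -> T, (forall n, ok (u n)) ->
     (forall n, lt (u n) (u n.+1)) -> False) ->
  ok t0 -> exists2 t, ok t & forall t', ok t' -> ~ lt t t'.
Proof.
move=> chain ok0; apply: contrapT => nomax.
have next (t : {t | ok t}) : exists t' : {t | ok t}, lt (sval t) (sval t').
  apply: contrapT => tmax; apply: nomax; exists (sval t) => [|t' okt' tt'].
    exact: svalP.
  by apply: tmax; exists (exist _ t' okt').
have [f fP] := choice next.
pose u n := iter n f (exist _ t0 ok0).
apply: (chain (fun n => sval (u n))) => n; first exact: svalP.
exact: fP.
Qed.

Lemma sum_delta (R : comPzRingType) (V : lmodType R) (n : nat) (g : 'I_n -> V) i :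
  \sum_j (j == i)%:R *: g j = g i.
Proof.
rewrite (bigD1 i) //= eqxx scale1r big1 ?addr0 // => j /negPf->.
by rewrite scale0r.
Qed.

(** * Submodules as sets and the ascending chain condition *)

Section SubmoduleSets.
Variables (R : comPzRingType) (V : lmodType R).
Implicit Types (N : set V).

Definition submod_set N := N 0 /\ forall r u v, N u -> N v -> N (r *: u + v).

Lemma submod_set0 N : submod_set N -> N 0. Proof. by case. Qed.

Lemma submod_setZ N r u : submod_set N -> N u -> N (r *: u).
Proof. by case=> N0 Nl Nu; rewrite -[_ *: _]addr0; apply: Nl. Qed.

Lemma submod_setD N u v : submod_set N -> N u -> N v -> N (u + v).
Proof. by case=> _ Nl Nu Nv; rewrite -[u]scale1r; apply: Nl. Qed.

Lemma submod_setB N u v : submod_set N -> N u -> N v -> N (u - v).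
Proof.
by move=> sN Nu Nv; rewrite addrC -scaleN1r; case: sN => _; apply.
Qed.

Lemma submod_set_sum N (T : Type) (r : seq T) (P : pred T) (F : T -> V) :
  submod_set N -> (forall i, P i -> N (F i)) -> N (\sum_(i <- r | P i) F i).
Proof.
move=> sN NF; apply: big_ind => //; first exact: submod_set0.
by move=> u v; apply: submod_setD.
Qed.

Lemma submod_setI N N' : submod_set N -> submod_set N' -> submod_set (N `&` N').
Proof.
move=> [N0 Nl] [N'0 N'l]; split=> // r u v [Nu N'u] [Nv N'v].
by split; [apply: Nl | apply: N'l].
Qed.

Definition asc (L : nat -> set V) := forall d, L d `<=` L d.+1.

Definition acc := forall L : nat -> set V,
  (forall d, submod_set (L d)) -> asc L ->
  exists d0, forall d, (d0 <= d)%N -> L d `<=` L d0.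

Lemma asc_le (L : nat -> set V) d d' : asc L -> (d <= d')%N -> L d `<=` L d'.
Proof.
move=> Lasc /subnKC <-; elim: (d' - d)%N => [|k IH]; first by rewrite addn0.
by rewrite addnS => x /IH; apply: Lasc.
Qed.

End SubmoduleSets.

Lemma acc_ring (R : comPzRingType) : noetherian R -> acc (R^o : lmodType R).
Proof.
move=> noethR L sL Lasc.
pose U : {pred R^o} := [pred x : R^o | `[< exists d, L d x >]].
have uc : submod_closed U.
  split=> [|r u v /asboolP[d Ldu] /asboolP[d' Ld'v]]; apply/asboolP.
    by exists 0%N; apply: submod_set0.
  exists (maxn d d'); apply: (sL _).2.
    exact: asc_le (leq_maxl _ _) _ Ldu.
  exact: asc_le (leq_maxr _ _) _ Ld'v.
pose J : ideal R := HB.pack_for (ideal R) U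
  (GRing.isSubmodClosed.Build R R^o _ uc).
have [n [g gJ]] := noethR J.
have Lg (i : 'I_n) : exists d, L d (g i).
  apply/asboolP; apply: (gJ (g i)).2.
  by exists (fun j => (j == i)%:R); rewrite sum_delta.
have [f fP] := choice Lg.
exists (\max_i f i)%N => d _ x Ldx.
have [c ->] := (gJ x).1 (asboolT (ex_intro _ d Ldx)).
apply: submod_set_sum => // i _; apply: submod_setZ => //.
exact: asc_le (leq_bigmax i) _ (fP i).
Qed.

(** Filter by the spans [F e] of the first [e] generators. The coefficients of [g e] form one chain
    of ideals for each [e]; once these [n] chains are stationary, an element of [L d] is reduced one
    generator at a time by subtracting elements of [L d0] with the same leading coefficient. *)
Lemma acc_fin_gen (R : comPzRingType) (V : lmodType R) (n : nat) (g : nat -> V) :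
  noetherian R ->
  (forall x : V, exists c : nat -> R, x = \sum_(i < n) c i *: g i) -> acc V.
Proof.
move=> noethR gV L sL Lasc.
pose F e : set V := [set x | exists c : nat -> R, x = \sum_(i < e) c i *: g i].
have FB e u v : F e u -> F e v -> F e (u - v).
  move=> [c ->] [c' ->]; exists (fun i => c i - c' i).
  by rewrite -sumrB; apply: eq_bigr => i _; rewrite scalerBl.
pose lead e d : set R^o := [set c | exists2 y, F e y & L d ((c : R) *: g e + y)].
have slead e d : submod_set (lead e d).
  split=> [|r u v [y [c ->] Ly] [z [c' ->] Lz]].
    exists 0; last by rewrite scale0r addr0; apply: submod_set0.
    by exists (fun=> 0); rewrite big1 // => i _; rewrite scale0r.
  exists (\sum_(i < e) (r * c i + c' i) *: g i).
    by exists (fun i => r * c i + c' i).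
  have := (sL d).2 r _ _ Ly Lz; congr (L d _).
  under [in RHS]eq_bigr do rewrite scalerDl -scalerA.
  rewrite big_split -scaler_sumr /= scalerDl -scalerA scalerDr !addrA.
  by congr (_ + _); rewrite addrAC.
have leadasc e : asc (lead e).
  by move=> d c [y Fy Ly]; exists y => //; apply: Lasc.
have pick e : (e < n)%N -> exists d0, forall d, (d0 <= d)%N ->
    forall d', (d <= d')%N -> lead e d' `<=` lead e d.
  move=> _; have [d0 d0P] := acc_ring noethR (slead e) (leadasc e).
  exists d0 => d d0d d' dd' c /(d0P _ (leq_trans d0d dd')).
  exact: asc_le.
have [d0 d0P] := bounded_uniform pick.
exists d0 => d d0d x Lx.
suff H e : (e <= n)%N -> forall x, F e x -> L d x -> L d0 x by apply: (H n).
elim: e => [_ {Lx}x [c ->] _|e IH en {Lx}x [c ->]].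
  by rewrite big_ord0; apply: submod_set0.
rewrite big_ord_recr /= addrC => Lx.
have [|y Fy Ly] := d0P d0 e (leqnn _) en d d0d (c e).
  by exists (\sum_(i < e) c i *: g i) => //; exists c.
set y' := \sum_(i < e) _ in Lx *.
rewrite -[_ + _](subrK (c e *: g e + y)); apply: submod_setD => //.
apply: IH; first exact: ltnW.
  rewrite opprD addrACA subrr add0r; apply: FB => //; by exists c.
by apply: submod_setB => //; apply: asc_le Ly.
Qed.

(** The same reduction, with the last possibly nonzero coordinate in place of the leading
    coefficient. *)
Lemma acc_ffun (R : comPzRingType) (V : lmodType R) (r : nat) :
  acc V -> acc {ffun 'I_r -> V}.
Proof.
move=> accV L sL Lasc.
pose lead (e : 'I_r) d : set V :=
  [set c | exists f, [/\ L d f, f e = c & forall j : 'I_r, (e < j)%N -> f j = 0]].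
have slead e d : submod_set (lead e d).
  split=> [|a _ _ [f [Lf <- f0]] [h [Lh <- h0]]].
    by exists 0; split=> [||j _]; rewrite ?ffunE //; apply: submod_set0.
  exists (a *: f + h); split=> [||j ej]; rewrite ?ffunE //; first exact: (sL _).2.
  by rewrite f0 // h0 // scaler0 addr0.
have leadasc e : asc (lead e).
  by move=> d c [f [Lf fe f0]]; exists f; split=> //; apply: Lasc.
have /choice[D DP] e := accV _ (slead e) (leadasc e).
exists (\max_e D e)%N => d Dd f Lf.
suff H e : (e <= r)%N -> forall f, L d f ->
    (forall j : 'I_r, (e <= j)%N -> f j = 0) -> L (\max_e D e)%N f.
  by apply: (H r) => // j; rewrite leqNgt ltn_ord.
elim: e => [_ {Lf}f _ f0|e IH er {Lf}f Lf f0].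
  have -> : f = 0 by apply/ffunP => j; rewrite f0 // ffunE.
  exact: submod_set0.
pose e' := Ordinal er.
have De : (D e' <= \max_e D e)%N by apply: leq_bigmax.
have [|h [Lh he h0]] := DP e' d (leq_trans De Dd) (f e').
  by exists f.
have {}Lh := asc_le Lasc De Lh.
rewrite -[f](subrK h); apply: submod_setD => //.
apply: IH => [||j]; first exact: ltnW.
  by apply: submod_setB => //; apply: asc_le Lh.
rewrite leq_eqVlt !ffunE => /predU1P[ej|ej]; last by rewrite f0 // h0 // subrr.
by rewrite (_ : j = e') ?he ?subrr //; apply: val_inj.
Qed.

(** * Hilbert's basis theorem for Rees modules *)

Section ReesPieces.
Variables (R : comPzRingType) (V : lmodType R).
Implicit Types (G : nat -> set V) (s : seq R).

(** Degree [n] part of the polynomials in [a], [a] having degree 1, over the graded family [G]. In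
    [rees] and [acc_rees] one has [e <= n.+1], so [n - j] is a true subtraction. *)
Definition powcomb (a : R) G (e n : nat) : set V :=
  [set x | exists2 c : nat -> V, forall j, (j < e)%N -> G (n - j)%N (c j)
                               & x = \sum_(j < e) a ^+ j *: c j].

(** This is J^n V for the ideal J generated by [s], built one generator at a time to allow induction
    on [s]. *)
Fixpoint rees s : nat -> set V :=
  if s is a :: s' then fun n => powcomb a (rees s') n.+1 n
  else fun n => if n is 0 then setT else [set 0].

Lemma powcomb_submod a G e n :
  (forall m, submod_set (G m)) -> submod_set (powcomb a G e n).
Proof.
move=> sG; split=> [|r u v [c cG ->] [c' c'G ->]].
  exists (fun=> 0) => [j _|]; first exact: submod_set0.
  by rewrite big1 // => i _; rewrite scaler0.
exists (fun j => r *: c j + c' j) => [j je|].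
  by apply: (sG _).2; [apply: cG | apply: c'G].
rewrite scaler_sumr -big_split; apply: eq_bigr => j _ /=.
by rewrite scalerDr !scalerA mulrC.
Qed.

Lemma powcomb_shift a G e n x : (forall m, submod_set (G m)) ->
  powcomb a G e n x -> powcomb a G e.+1 n.+1 (a *: x).
Proof.
move=> sG [c cG ->].
exists (fun j => if j is j'.+1 then c j' else 0) => [[|j] je|].
- exact: submod_set0.
- by rewrite subSS; apply: cG.
rewrite big_ord_recl scaler0 add0r scaler_sumr; apply: eq_bigr => j _.
by rewrite scalerA -exprS.
Qed.

Lemma powcomb_scale a b G e n x : (e <= n.+1)%N ->
  (forall m x, G m x -> G m.+1 (b *: x)) ->
  powcomb a G e n x -> powcomb a G e n.+1 (b *: x).
Proof.
move=> en bG [c cG ->]; exists (fun j => b *: c j) => [j je|].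
  by rewrite subSn; [apply/bG/cG | apply: leq_trans je en].
by rewrite scaler_sumr; apply: eq_bigr => j _; rewrite !scalerA mulrC.
Qed.

Lemma powcomb_widen a G e n : (forall m, submod_set (G m)) ->
  powcomb a G e n `<=` powcomb a G e.+1 n.
Proof.
move=> sG _ [c cG ->]; exists (fun j => if (j < e)%N then c j else 0) => [j _|].
  by case: ifP => [/cG//|_]; apply: submod_set0.
rewrite big_ord_recr /= ltnn scaler0 addr0.
by apply: eq_bigr => j _; rewrite ltn_ord.
Qed.

Lemma rees_submod s n : submod_set (rees s n).
Proof.
elim: s n => [[|n]|a s IH n] //=; last exact: powcomb_submod.
by split=> [//|r u v -> ->]; rewrite scaler0 addr0.
Qed.

Lemma rees0 s : rees s 0 = setT.
Proof.
elim: s => //= a s IH; apply/seteqP; split=> // x _.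
by exists (fun=> x) => [j _|]; rewrite ?sub0n ?IH // big_ord1 scale1r.
Qed.

Lemma rees_scale s n b x : b \in s -> rees s n x -> rees s n.+1 (b *: x).
Proof.
elim: s n b x => //= a s IH n b x; rewrite inE => /predU1P[-> | bs].
  exact/powcomb_shift/rees_submod.
move=> Hx; apply: powcomb_widen (rees_submod s) _ _.
by apply: powcomb_scale Hx => // m y; apply: IH.
Qed.

(* Elements of degree n are written as polynomials in the first generator a with
   coefficients in the Rees pieces of the remaining ones, as in Hilbert's basis
   theorem; such expressions need not be unique. *)
Lemma acc_rees s (L : nat -> nat -> set V) : acc V ->
  (forall d n, submod_set (L d n)) ->
  (forall d n, L d n `<=` rees s n) ->
  (forall d n, L d n `<=` L d.+1 n) ->
  (forall d n b x, b \in s -> L d n x -> L d n.+1 (b *: x)) ->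
  exists d0, forall d n, (d0 <= d)%N -> L d n `<=` L d0 n.
Proof.
move=> accV; elim: s L => [|a s IH] L sL LH Lasc Lb.
  have [d0 d0P] := accV (L^~ 0%N) (fun d => sL d 0%N) (fun d => Lasc d 0%N).
  exists d0 => d [|n] d0d; first exact: d0P.
  by move=> x /LH /= ->; apply: submod_set0.
pose F := powcomb a (rees s).
have sF e n : submod_set (F e n) by apply/powcomb_submod/rees_submod.
(* Leading coefficients at [a ^+ e], graded by their own degree [m]: for fixed [d] and [e] they form
   a graded family over [s], to which [IH] applies. *)
pose lead d e m : set V :=
  [set c | rees s m c /\
     exists2 y, F e (e + m)%N y & L d (e + m)%N (a ^+ e *: c + y)].
have slead d e m : submod_set (lead d e m).
  split=> [|r u v [Hu [y Fy Ly]] [Hv [z Fz Lz]]].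
    split; first exact: submod_set0 (rees_submod _ _).
    exists 0; first exact: submod_set0.
    by rewrite scaler0 addr0; apply: submod_set0.
  split; first exact: (rees_submod s m).2.
  exists (r *: y + z); first exact: (sF _ _).2.
  have := (sL d (e + m)%N).2 r _ _ Ly Lz; congr (L _ _ _).
  by rewrite !scalerDr !scalerA [r * _]mulrC addrACA.
have leadH d e m : lead d e m `<=` rees s m by move=> c [].
have leadb d e m b c : b \in s -> lead d e m c -> lead d e m.+1 (b *: c).
  move=> bs [Hc [y Fy Ly]]; split; first exact: rees_scale.
  exists (b *: y); rewrite addnS.
    apply: powcomb_scale Fy => [|k z]; last exact: rees_scale.
    by rewrite ltnW // ltnS leq_addr.
  rewrite scalerA mulrC -scalerA -scalerDr; apply: Lb => //.
  by rewrite inE bs orbT.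
have leadascd e m : asc (fun d => lead d e m).
  by move=> d c [Hc [y Fy Ly]]; split=> //; exists y => //; apply: Lasc.
have leadasce d m : asc (fun e => lead d e m).
  move=> e c [Hc [y Fy Ly]]; split=> //; exists (a *: y); rewrite addSn.
    exact/powcomb_shift/Fy/rees_submod.
  by rewrite exprS -scalerA -scalerDr; apply: Lb => //; rewrite mem_head.
(* As [lead] grows in both [d] and [e], the diagonal chain settles all [e >= D] at once; the
   finitely many [e < D] are treated separately. *)
have [||||D DP] := IH (fun d => lead d d) => //.
- by move=> d n; apply: subset_trans (leadasce _ _ _); apply: leadascd.
- by move=> d n b x; apply: leadb.
pose Q e d := forall m d', (d <= d')%N -> lead d' e m `<=` lead d e m.
have [|d1 d1P] := @bounded_uniform Q D.
  move=> e _; have [||||d1 d1P] := IH (fun d => lead d e) => //.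
  - by move=> d n; apply: leadascd.
  - by move=> d n b x; apply: leadb.
  exists d1 => d d1d m d' dd' c /(d1P _ _ (leq_trans d1d dd')).
  exact: (asc_le (leadascd _ _)).
pose d0 := maxn D d1.
have leadP d e m : (d0 <= d)%N -> lead d e m `<=` lead d0 e m.
  move=> d0d; have [eD|De] := ltnP e D.
    by apply: d1P => //; apply: leq_maxr.
  move=> c ledc; apply: (asc_le (leadasce _ _) De).
  apply: (asc_le (leadascd _ _) (leq_maxl _ _)).
  apply: (DP (maxn d e)); first by rewrite leq_max De orbT.
  apply: (asc_le (leadasce _ _) (leq_maxr d e)).
  exact: (asc_le (leadascd _ _) (leq_maxl d e)).
exists d0 => d n d0d x Lx.
(* Induction on the number of powers of [a]: an element of [L d0 n] with the same top coefficient is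
   subtracted. *)
suff H e : (e <= n.+1)%N -> forall x, F e n x -> L d n x -> L d0 n x.
  by apply: (H n.+1) => //; apply: LH Lx.
elim: e => [_ {Lx}x [c _ ->] _|e IHe en {Lx}x [c cH ->]].
  by rewrite big_ord0; apply: submod_set0.
rewrite big_ord_recr /= addrC => Lx.
have Fx : F e n (\sum_(i < e) a ^+ i *: c i).
  by exists c => // j je; apply/cH/ltnW.
set y' := \sum_(i < e) _ in Lx Fx *.
have nE : (n = e + (n - e))%N by rewrite subnKC.
have [|_ [y]] := leadP d e (n - e)%N d0d (c e).
  by split; [apply: cH | exists y'; rewrite -nE].
rewrite -nE => Fy Ly; rewrite -[_ + y'](subrK (a ^+ e *: c e + y)).
apply: submod_setD => //; apply: IHe; first exact: ltnW.
  by rewrite opprD addrACA subrr add0r; apply: submod_setB.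
by apply: submod_setB => //; apply: (asc_le (fun d => Lasc d n) d0d).
Qed.

End ReesPieces.

(** * Artin-Rees and colon submodules of the powers I^n M *)

Section GradedFamilies.
Variables (R : comPzRingType) (r : nat) (g : 'I_r -> R).

Section GeneratedFamily.
Variable V : lmodType R.
Implicit Types (N : set V) (G L : nat -> set V).

(** For a submodule N this is IN, with I generated by the [g i]: coefficients are absorbed into the
    [y i]. *)
Definition gmul N : set V :=
  [set x | exists2 y : 'I_r -> V, forall i, N (y i) & x = \sum_i g i *: y i].

Definition gclosed L := forall n i x, L n x -> L n.+1 (g i *: x).

Lemma gmul_submod N : submod_set N -> submod_set (gmul N).
Proof.
move=> sN; split=> [|a u v [y yN ->] [z zN ->]].
  exists (fun=> 0) => [_|]; first exact: submod_set0.
  by rewrite big1 // => i _; rewrite scaler0.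
exists (fun i => a *: y i + z i) => [i|]; first exact: sN.2.
rewrite scaler_sumr -big_split; apply: eq_bigr => i _ /=.
by rewrite scalerDr !scalerA mulrC.
Qed.

Lemma gmul_mem N i x : submod_set N -> N x -> gmul N (g i *: x).
Proof.
move=> sN Nx; exists (fun j => if j == i then x else 0) => [j|].
  by case: ifP => // _; apply: submod_set0.
rewrite (bigD1 i) //= eqxx big1 ?addr0 // => j /negPf->.
by rewrite scaler0.
Qed.

Lemma gmul_mono N N' : N `<=` N' -> gmul N `<=` gmul N'.
Proof. by move=> NN' _ [y yN ->]; exists y => // i; apply: NN'. Qed.

Section Noetherian.
Variable G : nat -> set V.
Hypotheses (accV : acc V) (Ggen : forall n, G n.+1 `<=` gmul (G n)).

Lemma graded_sub_rees n : G n `<=` rees (codom g) n.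
Proof.
elim: n => [|n IH]; first by rewrite rees0.
move=> _ /Ggen[y yG ->]; apply: submod_set_sum => [|i _].
  exact: rees_submod.
by apply: rees_scale (codom_f _ _) _; apply: IH.
Qed.

Lemma acc_graded (L : nat -> nat -> set V) :
  (forall d n, submod_set (L d n)) -> (forall d n, L d n `<=` G n) ->
  (forall d n, L d n `<=` L d.+1 n) -> (forall d, gclosed (L d)) ->
  exists d0, forall d n, (d0 <= d)%N -> L d n `<=` L d0 n.
Proof.
move=> sL LG Lasc Lg; apply: (@acc_rees _ _ (codom g)) => //.
  by move=> d n; apply: subset_trans (LG d n) (@graded_sub_rees n).
by move=> d n b x /codomP[i ->]; apply: Lg.
Qed.

(** A graded submodule of a Noetherian graded module is generated in bounded degree, which is the
    form of Artin-Rees used below. *)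
Lemma graded_fin_gen L :
  (forall n, submod_set (L n)) -> (forall n, L n `<=` G n) -> gclosed L ->
  exists n0, forall n, (n0 <= n)%N -> L n.+1 `<=` gmul (L n).
Proof.
move=> sL LG Lg.
have gmulL n : gmul (L n) `<=` L n.+1.
  by move=> _ [y yL ->]; apply: submod_set_sum => // i _; apply: Lg.
have iterS k N : iter k.+1 gmul N = gmul (iter k gmul N) by [].
have iter_mono k N N' : N `<=` N' -> iter k gmul N `<=` iter k gmul N'.
  by move=> NN'; elim: k => // k IH; apply: gmul_mono.
have iterL k n : iter k gmul (L n) `<=` L (n + k)%N.
  elim: k => [|k IH]; first by rewrite addn0.
  by rewrite addnS; apply: subset_trans (gmul_mono IH) (gmulL _).
have iter_sub k n : submod_set (iter k gmul (L n)).
  by elim: k => [|k IH]; [apply: sL | apply: gmul_submod].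
(* [T d] is the graded submodule generated by the pieces of [L] of degree at most [d]. Once this
   chain stops at [d0], the piece of degree n+1 is I^(n+1-d0) times that of degree [d0], hence lies
   in I times that of degree n. *)
pose T d n := iter (n - d) gmul (L (minn n d)).
have [||||d0 d0P] := acc_graded (L := T).
- by move=> d n; apply: iter_sub.
- move=> d n; apply: subset_trans (iterL _ _) _.
  by rewrite minnE subnK ?leq_subr.
- move=> d n; rewrite /T; have [nd|dn] := leqP n d.
    rewrite (minn_idPl (leqW nd)) (eqP nd : n - d = 0)%N.
    by rewrite (eqP (leqW nd) : n - d.+1 = 0)%N.
  rewrite (minn_idPr dn) -(subnSK dn) iterSr.
  exact: iter_mono.
- move=> d n i x; rewrite /T; have [dn|nd] := leqP d n.
    rewrite (minn_idPr (leqW dn)) subSn // iterS.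
    exact: gmul_mem.
  rewrite (minn_idPl nd) (eqP nd : n.+1 - d = 0)%N.
  by rewrite (eqP (ltnW nd) : n - d = 0)%N; apply: Lg.
exists d0 => n d0n x Lx.
have /(d0P _ _ (leqW d0n)) : T n.+1 n.+1 x by rewrite /T subnn minnn.
rewrite /T subSn // iterS (minn_idPr (leqW d0n)); apply: gmul_mono.
by apply: subset_trans (iterL _ _) _; rewrite subnKC.
Qed.

End Noetherian.

Definition gpow n : set V := iter n gmul setT.

Lemma gpow_submod n : submod_set (gpow n).
Proof. by elim: n => // n IH; apply: gmul_submod. Qed.

Lemma gpow_closed : gclosed gpow.
Proof. by move=> n i x; apply: gmul_mem; apply: gpow_submod. Qed.

Lemma gpow_le m n : (m <= n)%N -> gpow n `<=` gpow m.
Proof.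
move=> /subnK <-; elim: (n - m)%N => // k IH.
rewrite addSn; apply: subset_trans IH.
by elim: (k + m)%N => // j IHj; apply: gmul_mono.
Qed.

End GeneratedFamily.

Section PowersOfIdeal.
Variable M : lmodType R.
Hypothesis accM : acc M.

Lemma gpow_fin_gen (L : nat -> set M) :
  (forall n, submod_set (L n)) -> (forall n, L n `<=` gpow n) -> gclosed L ->
  exists n0, forall n, (n0 <= n)%N -> L n.+1 `<=` gmul (L n).
Proof. by apply: graded_fin_gen => // n; apply: subset_refl. Qed.

Definition gsocle : set M := [set x | forall i, g i *: x = 0].

(** The graded family of intersections is generated in bounded degree, so its high pieces lie in I
    (0 :_M I) = 0. *)
Lemma gsocle_gpow :
  exists k, forall n, (k <= n)%N -> gpow n `&` gsocle `<=` [set 0].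
Proof.
have [|||n0 n0P] := @gpow_fin_gen (fun n => gpow n `&` gsocle).
- move=> n; apply: submod_setI; first exact: gpow_submod.
  split=> [i|a u v su sv i]; first by rewrite scaler0.
  by rewrite scalerDr sv scalerA mulrC -scalerA su scaler0 addr0.
- by move=> n x [].
- move=> n i x [Gx sx]; split; first exact: gpow_closed.
  by move=> j; rewrite sx scaler0.
exists n0.+1 => -[//|n] n0n x /n0P[//|y yL ->] /=.
by rewrite big1 // => i _; apply: (yL i).2.
Qed.

(** In high degrees the associated graded module has no nonzero element killed by I. Lifts of such
    elements form a graded family with L (n+1) inside I L n, and I L n lies in I^(n+2) M by the
    choice of the family. *)
Lemma gpow_colon_local : exists k, forall n (x : M), (k <= n)%N -> gpow n x ->
  (forall i, gpow n.+2 (g i *: x)) -> gpow n.+1 x.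
Proof.
have [|||n0 n0P] := @gpow_fin_gen
  (fun n => gpow n `&` [set x | forall i, gpow n.+2 (g i *: x)]).
- move=> n; apply: submod_setI; first exact: gpow_submod.
  split=> [i|a u v su sv i].
    by rewrite scaler0; exact: submod_set0 (gpow_submod _ _).
  rewrite scalerDr scalerA mulrC -scalerA.
  by apply: (gpow_submod _ _).2.
- by move=> n x [].
- move=> n i x [Gx sx]; split; first exact: gpow_closed.
  by move=> j; apply: gpow_closed; apply: gpow_le (sx i).
exists n0.+1 => -[//|n] x n0n Gx sx.
have [//|//|y yL ->] := n0P n _ x.
apply: submod_set_sum => [|i _]; first exact: gpow_submod.
exact: (yL i).2.
Qed.

(* Artin-Rees for the image of x |-> (g_i x)_i in the direct sum of r copies
   of M. *)
Lemma gpow_colon_approx : exists n0, forall m (x : M),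
  (forall i, gpow (n0 + m) (g i *: x)) ->
  exists2 x', gpow m x' & forall i, g i *: x' = g i *: x.
Proof.
pose V : lmodType R := {ffun 'I_r -> M}.
pose G n : set V := [set f | forall i, gpow n (f i)].
pose phi (x : M) : V := [ffun i => g i *: x].
have sG n : submod_set (G n).
  split=> [i|a u v Gu Gv i]; rewrite !ffunE.
    exact: submod_set0 (gpow_submod _ _).
  by apply: (gpow_submod _ _).2.
have sphi : submod_set (range phi).
  split=> [|a u v [x _ <-] [y _ <-]].
    by exists 0 => //; apply/ffunP => i; rewrite !ffunE scaler0.
  exists (a *: x + y) => //; apply/ffunP => i.
  by rewrite !ffunE scalerDr !scalerA mulrC.
have Ggen n : G n.+1 `<=` gmul (G n).
  move=> f Gf; have /choice[y yP] : forall i, exists y : 'I_r -> M,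
      (forall j, gpow n (y j)) /\ f i = \sum_j g j *: y j.
    by move=> i; have [y] := Gf i; exists y.
  exists (fun j => [ffun i => y i j]) => [j i|].
    by rewrite ffunE; apply: (yP i).1.
  apply/ffunP => i; rewrite (yP i).2 sum_ffunE; apply: eq_bigr => j _.
  by rewrite !ffunE.
have [|||n0 n0P] :=
  graded_fin_gen (acc_ffun accM) Ggen (L := fun n => G n `&` range phi).
- by move=> n; apply: submod_setI.
- by move=> n f [].
- move=> n i f [Gf phif]; split; last exact: submod_setZ.
  by move=> j; rewrite ffunE; apply: gpow_closed.
(* Iterating [n0P] places this intersection in I^m (range phi) = phi (I^m M). *)
have phiP m f : (G (n0 + m)%N `&` range phi) f -> exists2 x, gpow m x & f = phi x.
  elim: m f => [|m IH] f; first by move=> [_ [x _ <-]]; exists x.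
  rewrite addnS => /n0P[|y yL ->]; first exact: leq_addr.
  have /choice[x xP] : forall i, exists x, gpow m x /\ y i = phi x.
    by move=> i; have [x] := IH _ (yL i); exists x.
  exists (\sum_i g i *: x i); first by exists x => // i; apply: (xP i).1.
  apply/ffunP => i; rewrite sum_ffunE ffunE scaler_sumr; apply: eq_bigr => j _.
  by rewrite (xP j).2 !ffunE !scalerA mulrC.
exists n0 => m x Gx; have [|x' Gx' phix'] := phiP m (phi x).
  by split=> [i|]; [rewrite ffunE; apply: Gx | exists x].
by exists x' => // i; have /ffunP/(_ i) := phix'; rewrite !ffunE => ->.
Qed.

(** This is (I^(n+1) M :_M I) = I^n M + (0 :_M I), the second component being x - x'. Artin-Rees
    only puts x' in I^k M for a fixed k; [gpow_colon_local] then raises the degree step by step up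
    to n. *)
Lemma gpow_colon : exists k, forall n (x : M), (k <= n)%N ->
  (forall i, gpow n.+1 (g i *: x)) ->
  exists2 x', gpow n x' & forall i, g i *: x' = g i *: x.
Proof.
have [k kP] := gpow_colon_local; have [n0 n0P] := gpow_colon_approx.
exists (n0 + k)%N => n x n0kn Gx.
have [i|x' Gx' gx'] := n0P k x.
  by apply: gpow_le (Gx i); apply: leqW.
exists x' => //.
suff : forall j, (k + j <= n)%N -> gpow (k + j) x'.
  have kn : (k <= n)%N by apply: leq_trans n0kn; apply: leq_addl.
  by move=> /(_ (n - k)%N); rewrite subnKC //; apply.
elim=> [|j IH] kjn; first by rewrite addn0.
rewrite addnS in kjn *; apply: kP; first exact: leq_addr.
  exact/IH/ltnW.
by move=> i; rewrite gx'; apply: gpow_le (Gx i).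
Qed.

End PowersOfIdeal.
End GradedFamilies.

(** * Stationary chains of sets, primes and associated primes *)

Lemma asc_stationary (T : eqType) (B : nat -> set T) (S : seq T) (k : nat) :
  (forall n, (k <= n)%N -> B n `<=` B n.+1) ->
  (forall n P, (k <= n)%N -> B n P -> P \in S) ->
  exists n0, forall n, (n0 <= n)%N -> B n = B n0.
Proof.
move=> Basc BS.
have Ble m n : (k <= m)%N -> (m <= n)%N -> B m `<=` B n.
  move=> km /subnKC <-; elim: (n - m)%N => [|i IH]; first by rewrite addn0.
  rewrite addnS; apply: subset_trans IH (Basc _ _).
  exact: leq_trans km (leq_addr _ _).
(* [f P] is a stage by which [P] has entered; an element that never enters gets 0. The maximum of
   [f] over [S] then bounds all entries. *)
have /choice[f fP] (P : T) : exists m, forall n, (k <= n)%N -> B n P ->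
    (k <= m)%N /\ B m P.
  have [[m [km Bm]]|noB] := pselect (exists m, (k <= m)%N /\ B m P).
    by exists m.
  by exists 0%N => n kn Bn; case: noB; exists n.
pose n0 := maxn k (\max_(P <- S) f P).
have kn0 : (k <= n0)%N by apply: leq_maxl.
exists n0 => n n0n; apply/seteqP; split; last exact: Ble.
have kn := leq_trans kn0 n0n.
move=> P BP; have [kf Bf] := fP P n kn BP.
apply: Ble Bf => //; rewrite leq_max; apply/orP; right.
by apply: (@leq_bigmax_seq _ _ _ f); [apply: BS BP | ].
Qed.

Section PrimeSets.
Variable R : comPzRingType.
Implicit Types P : set R.

Definition prime_set P := ~ P 1 /\ forall a b, P (a * b) -> P a \/ P b.

Lemma prime_set_exp P a n : prime_set P -> P (a ^+ n) -> P a.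
Proof.
move=> [P1 PM]; elim: n => [|n IH]; first by rewrite expr0.
by rewrite exprS => /PM[].
Qed.

(** If [P] differed from every [Q i], each [Q i] would contain some [c i] outside [P]; the product
    of the [c i] lies in all [Q i], hence in [P], against primality. *)
Lemma prime_set_bigcap (T : finType) P (Q : T -> set R) : prime_set P ->
  (forall i a b, Q i b -> Q i (a * b)) ->
  P = [set a | forall i, Q i a] -> exists i, P = Q i.
Proof.
move=> [P1 PM] QM PQ; apply: contrapT => noi.
have /choice[c cP] i : exists a, Q i a /\ ~ P a.
  apply: contrapT => noa; apply: noi; exists i; apply/seteqP; split=> a.
    by rewrite PQ => /(_ i).
  by move=> Qa; apply: contrapT => nPa; apply: noa; exists a.
have : P (\prod_i c i).
  rewrite PQ => i; rewrite (bigD1 i) //= mulrC; apply: QM.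
  exact: (cP i).1.
apply: (big_ind (fun a => ~ P a)) => // [a b nPa nPb /PM[]//|i _].
exact: (cP i).2.
Qed.

End PrimeSets.

Section AssociatedPrimesOfPairs.
Variables (R : comPzRingType) (M : lmodType R).
Implicit Types (N : set M).

(** For a submodule N, the annihilator of the class of x in M / N. *)
Definition colon N (x : M) : set R := [set a | N (a *: x)].

Lemma colonE N x a : colon N x a = N (a *: x). Proof. by []. Qed.

(* The associated primes of (N' + N) / N. *)
Definition ass (N' N : set M) : set (set R) :=
  [set P | prime_set P /\ exists2 x, N' x & P = colon N x].

Lemma colonM N x a b : submod_set N -> colon N x b -> colon N x (a * b).
Proof. by move=> sN; rewrite !colonE -scalerA; apply: submod_setZ. Qed.

Lemma colon_submod N x : submod_set N -> submod_set (colon N x : set R^o).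
Proof.
move=> sN; split=> [|a u v Nu Nv]; rewrite ?colonE.
  by rewrite scale0r; apply: submod_set0.
by rewrite scalerDl -scalerA; apply: sN.2.
Qed.

Lemma ass_mono N1 N2 N : N1 `<=` N2 -> ass N1 N `<=` ass N2 N.
Proof.
by move=> N12 P [pP [x N1x PE]]; split=> //; exists x => //; apply: N12.
Qed.

End AssociatedPrimesOfPairs.

(** * Stability of Ass (I^n M / I^(n+1) M) *)

Section Brodmann.
Variables (R : comPzRingType) (r : nat) (g : 'I_r -> R) (M : lmodType R).
Hypotheses (noethR : noetherian R) (accM : acc M).
Notation gpow := (gpow g).

Definition ass_gr n := ass (gpow n : set M) (gpow n.+1).

(** By [gpow_colon_local], the annihilator of the class of x in degree n is the intersection of
    those of the [g i *: x] in degree n+1; being prime, it equals one of them. *)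
Lemma ass_gpow_asc : exists k, forall n, (k <= n)%N ->
  ass_gr n `<=` ass_gr n.+1.
Proof.
have [k kP] := gpow_colon_local g accM.
exists k => n kn P [pP [x Gx Px]]; split=> //.
have Pcap : P = [set a | forall i, colon (gpow n.+2) (g i *: x) a].
  rewrite Px; apply/seteqP; split=> a ax.
    move=> i; rewrite colonE scalerA mulrC -scalerA.
    exact: gpow_closed.
  apply: kP => // [|i]; first by apply: submod_setZ (gpow_submod _ _ _) Gx.
  by move: (ax i); rewrite colonE !scalerA mulrC.
have [|i Pi] := prime_set_bigcap pP _ Pcap.
  by move=> i a b; apply: colonM; apply: gpow_submod.
by exists (g i *: x) => //; apply: gpow_closed.
Qed.

Lemma gpow_mul (L : nat -> set M) m j (c : R^o) y :
  (forall i, submod_set (L i)) -> gclosed g L ->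
  L m y -> (gpow j : set R^o) c -> L (m + j)%N ((c : R) *: y).
Proof.
move=> sL Lg Ly; elim: j c => [|j IH] c.
  by rewrite addn0 => _; apply: submod_setZ.
move=> [b bG ->]; rewrite addnS scaler_suml.
apply: submod_set_sum => // i _.
by rewrite -[g i *: b i]/(g i * (b i : R)) -scalerA; exact: Lg (IH _ (bG i)).
Qed.

Section GradedExtension.
Variables (L : nat -> set M) (n : nat) (x : M).
Hypotheses (sL : forall m, submod_set (L m)) (Lg : gclosed g L).

(** The piece of degree m - n of R[It]. The test is needed because truncated subtraction would give
    the whole ring below degree n. *)
Definition homog_mult m : set R^o := if (n <= m)%N then gpow (m - n) else [set 0].

Lemma homog_mult_submod m : submod_set (homog_mult m).
Proof.
rewrite /homog_mult; case: ifP => _; first exact: gpow_submod.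
by split=> // a u v -> ->; rewrite scaler0 addr0.
Qed.

Lemma homog_mult_closed : gclosed g homog_mult.
Proof.
move=> m i c; rewrite /homog_mult; have [nm|mn ->] := leqP n m.
  by rewrite leqW // subSn //; apply: gpow_closed.
by rewrite scaler0; apply: submod_set0 (homog_mult_submod _).
Qed.

Lemma homog_mult_scale (H : nat -> set M) m (c : R^o) y :
  (forall i, submod_set (H i)) -> gclosed g H ->
  H n y -> homog_mult m c -> H m ((c : R) *: y).
Proof.
move=> sH Hg Hy; rewrite /homog_mult; case: ifP => [nm hc|_ ->].
  by rewrite -(subnKC nm); apply: gpow_mul.
by rewrite scale0r; apply: submod_set0.
Qed.

(** Degree m of the graded submodule L + R[It] x, with x placed in degree n. *)
Definition extend m : set M :=
  [set y | exists2 l, L m l & exists2 c, homog_mult m c & y = l + (c : R) *: x].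

Lemma extend_submod m : submod_set (extend m).
Proof.
have [sl sh] := (sL m, homog_mult_submod m); split=> [|a u v].
  exists 0; first exact: submod_set0.
  by exists 0; [apply: submod_set0 | rewrite scale0r addr0].
move=> [l Ll [c hc ->]] [l' Ll' [c' hc' ->]].
exists (a *: l + l'); first exact: sl.2.
exists (a *: c + c'); first exact: sh.2.
by rewrite scalerDl -scalerA scalerDr addrACA.
Qed.

Lemma extend_closed : gclosed g extend.
Proof.
move=> m i _ [l Ll [c hc ->]]; exists (g i *: l); first exact: Lg.
exists (g i *: c); first exact: homog_mult_closed.
by rewrite scalerDr scalerA.
Qed.

Lemma sub_extend m : L m `<=` extend m.
Proof.
move=> l Ll; exists l => //; exists 0.
  exact: submod_set0 (homog_mult_submod _).
by rewrite scale0r addr0.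
Qed.

Lemma extend_gen : extend n x.
Proof.
exists 0; first exact: submod_set0.
by exists 1; rewrite ?scale1r ?add0r // /homog_mult leqnn subnn.
Qed.

Hypotheses (Gx : gpow n x) (xmax : forall m y, gpow m y -> ~ L m y ->
  colon (L n) x `<=` colon (L m) y -> colon (L m) y `<=` colon (L n) x).

(** Passing to a multiple can only enlarge the annihilator modulo [L], and by [xmax] that of x is
    already maximal. *)
Lemma colon_homog_mult m c : homog_mult m c -> ~ L m ((c : R) *: x) ->
  colon (L m) ((c : R) *: x) = colon (L n) x.
Proof.
move=> hc cx; have sub : colon (L n) x `<=` colon (L m) ((c : R) *: x).
  move=> a ax; rewrite colonE scalerA mulrC -scalerA.
  exact: homog_mult_scale.
apply/seteqP; split=> //; apply: xmax => //.
exact: homog_mult_scale (gpow_submod g M) (@gpow_closed _ _ g M) Gx hc.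
Qed.

(** Let P be the annihilator of w = l + cx modulo N. If some aw lies in [L m] with a outside P, then
    aw also has annihilator P, since P is prime. Otherwise P is the annihilator of w modulo [L m],
    which is that of cx, hence that of x. *)
Lemma ass_extend (N : set M) m : submod_set N -> N `<=` L m ->
  ass (extend m) N `<=` ass (L m) N `|` [set colon (L n) x].
Proof.
move=> sN NL P [pP [_ [l Ll [c hc ->]] PE]].
have lc a : L m (a *: (l + (c : R) *: x)) <-> L m (a *: (c *: x)).
  have La : L m (a *: l) by apply: submod_setZ.
  rewrite scalerDr; split=> Lx; last exact: submod_setD.
  by rewrite -[_ *: (_ *: _)](addKr (a *: l)) addrC; apply: submod_setB.
have [[a [La nPa]]|noa] :=
  pselect (exists a, L m (a *: (l + (c : R) *: x)) /\ ~ P a).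
  left; split=> //; exists (a *: (l + (c : R) *: x)) => //.
  apply/seteqP; split=> b.
    rewrite PE !colonE scalerA mulrC -scalerA.
    exact: submod_setZ.
  rewrite colonE scalerA => ba; have {ba} : P (b * a) by rewrite PE.
  by move=> /pP.2[].
right; rewrite /= -(@colon_homog_mult m c) // => [|Lcx].
  apply/seteqP; split=> a.
    by rewrite PE => /NL/lc.
  by move=> /lc La; apply: contrapT => nPa; apply: noa; exists a.
apply: noa; exists 1; split; last exact: pP.1.
by apply/lc; rewrite scale1r.
Qed.

End GradedExtension.

(* A graded submodule, maximal among those with finitely many associated
   primes modulo the shifted Rees module, is the whole Rees module: otherwise
   adjoining an element with maximal annihilator adds a single prime. *)
Lemma ass_gpow_finite : exists S : seq (set R),
  forall n P, ass_gr n P -> P \in S.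
Proof.
pose ok (L : nat -> set M) := [/\ forall n, submod_set (L n), gclosed g L,
  forall n, gpow n.+1 `<=` L n, forall n, L n `<=` gpow n
  & exists S : seq (set R), forall n P, ass (L n) (gpow n.+1) P -> P \in S].
pose lt (L L' : nat -> set M) :=
  (forall n, L n `<=` L' n) /\ exists n, ~ L' n `<=` L n.
(* The starting family is the shifted Rees module itself; it has no associated primes, every colon
   there containing 1. *)
have [||L [sL Lg GL LG [S SP]] Lmax] :=
  @exists_maximal _ ok lt (fun n => gpow n.+1).
- move=> u uok ult.
  have [d|d n|d n|d|d0 d0P] :=
    acc_graded accM (fun n => @subset_refl _ (gpow n.+1)) (L := u).
  + by case: (uok d).
  + by case: (uok d) => _ _ _ + _; apply.
  + exact: (ult d).1.
  + by case: (uok d).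
  have [n] := (ult d0).2; apply; exact: d0P.
- split=> [n|n i x|n|n|]; first exact: gpow_submod.
  + exact: gpow_closed.
  + exact: subset_refl.
  + exact: gpow_le.
  exists [::] => n P [[P1 _] [y Gy PE]]; case: P1.
  by rewrite PE colonE scale1r.
suff LGE i : gpow i `<=` L i.
  by exists S => n P /(ass_mono (LGE n)); apply: SP.
move=> z Gz; apply: contrapT => nLz.
(* Pairs (degree, element) range over the homogeneous elements of the Rees module outside [L]; the
   chain condition on R yields one with maximal annihilator. *)
pose C (t : nat * M) := colon (L t.1) t.2.
pose okx (t : nat * M) := gpow t.1 t.2 /\ ~ L t.1 t.2.
have [|//|[n x] [/= Gx nLx] xmax] := @exists_maximal _ okx
    (fun t t' => C t `<=` C t' /\ ~ C t' `<=` C t) (i, z).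
  move=> u _ ult.
  have [d|d|d0 d0P] := acc_ring noethR (L := fun d => C (u d)).
  - exact: colon_submod.
  - exact: (ult d).1.
  - by case: (ult d0) => _; apply; apply: d0P.
have xmax' m y : gpow m y -> ~ L m y ->
    colon (L n) x `<=` colon (L m) y -> colon (L m) y `<=` colon (L n) x.
  move=> Gy nLy sub; apply: contrapT => nsub.
  exact: (xmax (m, y)).
apply: (Lmax (extend L n x)).
  split.
  - by move=> m; apply: extend_submod.
  - exact: extend_closed.
  - by move=> m y Gy; apply: sub_extend => //; apply: GL.
  - move=> m _ [l Ll [c hc ->]].
    apply: submod_setD (gpow_submod _ _ _) (LG _ _ Ll) _.
    exact: homog_mult_scale (gpow_submod g M) (@gpow_closed _ _ g M) Gx hc.
  - exists (colon (L n) x :: S) => m P.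
    move=> /(ass_extend sL Lg Gx xmax' (gpow_submod g M m.+1) (GL m)).
    by rewrite inE => -[/SP ->|/= ->]; rewrite ?orbT ?eqxx.
split=> [m|]; first exact: sub_extend.
by exists n => /(_ x (extend_gen _ _ sL)).
Qed.

Lemma ass_gpow_stationary : exists n0, forall n, (n0 <= n)%N ->
  ass_gr n = ass_gr n0.
Proof.
have [k kP] := ass_gpow_asc; have [S SP] := ass_gpow_finite.
by apply: (asc_stationary kP) => n P _; apply: SP.
Qed.

End Brodmann.

(** * From sets back to quotient and submodule types *)

Section Translation.
Variable R : comPzRingType.

Lemma smul_mem (M : lmodType R) (I : ideal R) (N : submodule M) (a : R) x :
  a \in I -> x \in N -> a *: x \in smul I N.
Proof.
move=> aI xN; apply/asboolP; exists 1%N, (fun=> a), (fun=> x).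
by rewrite big_ord1.
Qed.

(** Associativity of products: the left side is (I^n) M, the right side I (I (... M)). *)
Lemma ipow_gpow (I : ideal R) (r : nat) (g : 'I_r -> R) (M : lmodType R) n :
  (forall a : R^o,
     a \in I <-> exists c : 'I_r -> R, a = \sum_i c i *: (g i : R^o)) ->
  [set x | x \in ipow I M n] = gpow g n.
Proof.
move=> gI; have gmemI i : (g i : R^o) \in I.
  by apply/gI; exists (fun j => (j == i)%:R); rewrite sum_delta.
elim: n => [|n IH]; apply/seteqP; split=> x //=.
- by move=> _; rewrite -[x]scale1r; apply: smul_mem.
- have sG : submod_set (gmul g (gpow g n : set M)).
    exact/gmul_submod/gpow_submod.
  move=> /asboolP[m [a [y [aI _ ->]]]]; apply: submod_set_sum => // i _.
  have /asboolP[m' [b [z [bI zJ ->]]]] := aI i.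
  rewrite scaler_suml; apply: submod_set_sum => // j _.
  have [c ->] := (gI _).1 (bI j).
  rewrite scaler_suml scaler_suml; apply: submod_set_sum => // k _.
  suff : gmul g (gpow g n) (g k *: (c k *: ((z j : R) *: y i))).
    by rewrite !scalerA [g k * _]mulrC.
  apply: gmul_mem; first exact: gpow_submod.
  apply: submod_setZ; first exact: gpow_submod.
  by rewrite -IH; apply: smul_mem.
move=> [y yG ->]; apply: rpred_sum => i _.
have := yG i; rewrite -/(gpow g n (y i)) -IH => /asboolP[m [a [z [aJ _ ->]]]].
rewrite scaler_sumr; apply: rpred_sum => j _; rewrite scalerA.
by apply: smul_mem => //; apply: smul_mem.
Qed.

Lemma prime_idealE (M : lmodType R) (x : M) :
  prime_ideal (ann x) <-> prime_set [set a : R | a \in ann x].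
Proof. by split=> [[/negP ? ?]|[? ?]]; split=> //; apply/negP. Qed.

Lemma Ass_quotmod (M : lmodType R) (N : submodule M) :
  Ass (quotmod N) = ass setT [set x | x \in N].
Proof.
have annE (x : M) : [set a : R | a \in ann (\pi_(quotmod N) x)%qT] =
    colon [set x | x \in N] x.
  apply/seteqP; split=> a.
    rewrite /= inE => /eqP ax.
    have /quotmod_eqP : \pi_(quotmod N)%qT (a *: x) = \pi_(quotmod N)%qT 0.
      by rewrite -quotmod_piZ quotmod_pi0.
    by rewrite subr0.
  move=> ax; rewrite /= inE; apply/eqP.
  apply: etrans (quotmod_piZ N a x) _; rewrite -quotmod_pi0.
  by apply/quotmod_eqP; rewrite subr0.
apply/seteqP; split=> P.
  move=> [q [/prime_idealE pq PE]]; rewrite -[q]reprK annE in pq PE.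
  by split; rewrite PE //; exists (repr q).
move=> [pP [x _ PE]]; exists (\pi_(quotmod N)%qT x).
by rewrite annE -PE; split=> //; apply/prime_idealE; rewrite annE -PE.
Qed.

Lemma Ass_subquot (M : lmodType R) (N' N : submodule M) :
  Ass (subquot N' N) = ass [set x | x \in N'] [set x | x \in N].
Proof.
rewrite Ass_quotmod; apply/seteqP; split=> P [pP].
  move=> [x _ PE]; split=> //; exists (val x); first exact: (valP x).
  by rewrite PE.
move=> [x xN' PE]; split=> //; exists (exist _ x xN' : submod N') => //.
Qed.

Lemma Ass_submod (M : lmodType R) (N : submodule M) :
  Ass (submod N) = ass [set x | x \in N] [set 0].
Proof.
have annE (x : submod N) : [set a : R | a \in ann x] = colon [set 0] (val x).
  apply/seteqP; split=> a; rewrite /= inE colonE /=.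
    by move=> /eqP/(congr1 val); rewrite linearZ raddf0.
  by move=> ax; apply/eqP/val_inj; rewrite linearZ raddf0.
apply/seteqP; split=> P.
  move=> [x [/prime_idealE px PE]]; rewrite annE in px PE.
  by split; rewrite PE //; exists (val x) => //; apply: (valP x).
move=> [pP [x xN PE]]; exists (exist _ x xN : submod N).
by rewrite annE -PE; split=> //; apply/prime_idealE; rewrite annE -PE.
Qed.

End Translation.

(** * Splitting off the socle, and the conclusion *)

Lemma ass_gpow_split (R : comPzRingType) (r : nat) (g : 'I_r -> R)
    (M : lmodType R) : acc M ->
  exists n0, forall n, (n0 <= n)%N ->
    ass setT (gpow g n.+1 : set M) =
    ass (gsocle g (M := M)) [set 0] `|` ass_gr g M n.
Proof.
move=> accM; have [k kP] := gsocle_gpow g accM.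
have [k' k'P] := gpow_colon g accM.
exists (maxn k k') => n; rewrite geq_max => /andP[kn k'n].
have disj (x : M) : gpow g n x -> gsocle g x -> x = 0.
  by move=> Gx sx; apply: (kP n kn x).
have sG := gpow_submod g M.
have gs a x : gsocle g x -> gsocle g (a *: x : M).
  by move=> sx i; rewrite scalerA mulrC -scalerA sx scaler0.
apply/seteqP; split=> P; last first.
  (* A socle element has the same annihilator modulo I^(n+1) M as in M, because its multiples stay
     in the socle, which meets I^n M trivially. *)
  move=> [[pP [x sx PE]]|]; last exact: ass_mono.
  split=> //; exists x => //; rewrite PE; apply/seteqP.
  split=> a; rewrite !colonE.
    by move=> ax; rewrite (ax : a *: x = 0); apply: submod_set0.
  by move=> Gax; apply: disj (gs _ _ sx); apply: gpow_le Gax.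
move=> [pP [x _ PE]].
(* [g i ^+ n.+1] maps M into I^(n+1) M, so it lies in the prime P. *)
have gP i : P (g i).
  apply: (@prime_set_exp _ _ _ n.+1) => //; rewrite PE colonE.
  elim: {PE kn k'n disj pP}n.+1 => // m IH.
  by rewrite exprS -scalerA; apply: gpow_closed.
have [i|z Gz gz] := k'P n x k'n; first by have := gP i; rewrite PE.
pose y := x - z.
have sy : gsocle g y by move=> i; rewrite scalerBr gz subrr.
(* The two components of x: [true] is y in the socle, [false] is z in I^n M. If ax lies in I^(n+1)
   M, then ay = ax - az lies in the socle and in I^n M, so ay = 0 and az = ax. *)
have Pcap : P = [set a | forall b : bool,
    (if b then colon [set 0] y else colon (gpow g n.+1) z) a].
  rewrite PE; apply/seteqP; split=> a.
    rewrite colonE => Gax.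
    have ay0 : a *: y = 0.
      apply: disj; last exact: gs.
      rewrite scalerBr; apply: submod_setB => //; last exact: submod_setZ.
      exact: gpow_le Gax.
    by case=> //; rewrite colonE -[z](subKr x) -/y scalerBr ay0 subr0.
  move=> az; rewrite colonE -[x](subrK z) scalerDr; apply: submod_setD => //.
    by rewrite (az true : a *: y = 0); apply: submod_set0.
  exact: (az false).
have [|[] Pb] := prime_set_bigcap pP _ Pcap.
- case=> a b; last exact: colonM.
  apply: colonM; split=> // c u v -> ->; by rewrite scaler0 addr0.
- by left; split=> //; exists y.
- by right; split=> //; exists z.
Qed.

Lemma acc_full (R : comPzRingType) (M : lmodType R) :
  noetherian R -> fin_gen (full M) -> acc M.
Proof.
(* [inord] needs a nonempty ordinal type, so the empty generating family is handled apart. *)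
move=> noethR [n [g gM]]; case: n g gM => [|n] g gM.
  apply: (@acc_fin_gen _ _ 0 (fun=> 0)) => // x.
  by exists (fun=> 0); have [c ->] := (gM x).1 isT; rewrite !big_ord0.
apply: (@acc_fin_gen _ _ n.+1 (fun i => g (inord i))) => // x.
have [c ->] := (gM x).1 isT; exists (fun i => c (inord i)).
by apply: eq_bigr => i _; rewrite inord_val.
Qed.

Theorem theorem1p2 (R : comPzRingType) (noethR : noetherian R)
    (I : ideal R) (M : lmodType R) (fgM : fin_gen (full M)) :
  for_large (fun n : nat =>
    Ass (quotmod (ipow I M n)) =
    Ass (submod (annih_submod M I))
      `|` Ass (subquot (ipow I M n.-1) (ipow I M n)))
  /\ Astable I M = Ass (submod (annih_submod M I)) `|` Bstable I M.
Proof.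
have accM := acc_full noethR fgM; have [r [g gI]] := noethR I.
have ipowE n := ipow_gpow M n gI.
have socleE : [set x | x \in annih_submod M I] = gsocle (g : 'I_r -> R) (M := M).
  apply/seteqP; split=> x /=.
    move=> /asboolP xI i; apply: xI; apply/gI.
    by exists (fun j => (j == i)%:R); rewrite sum_delta.
  move=> sx; apply/asboolP => a /gI[c ->]; rewrite scaler_suml big1 // => i _.
  by rewrite -[c i *: g i]/(c i * (g i : R)) -scalerA sx scaler0.
have [k kP] := ass_gpow_split (g : 'I_r -> R) accM.
have main : for_large (fun n : nat => Ass (quotmod (ipow I M n)) =
    Ass (submod (annih_submod M I))
      `|` Ass (subquot (ipow I M n.-1) (ipow I M n))).
  (* [ass_gr n] concerns I^n M / I^(n+1) M, so the index shifts by one and n = 0 is excluded. *)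
  exists k.+1 => -[//|n] kn; rewrite Ass_quotmod Ass_submod Ass_subquot.
  by rewrite socleE !ipowE kP.
split=> //; have [k' k'P] := ass_gpow_stationary (g : 'I_r -> R) noethR accM.
have Blarge : for_large (fun n =>
    Ass (subquot (ipow I M n.-1) (ipow I M n)) = ass_gr (g : 'I_r -> R) M k').
  by exists k'.+1 => -[//|n] kn; rewrite Ass_subquot !ipowE -(k'P n).
(* The right side of [main] is eventually constant, so its limit is also the stable value of the
   left side. *)
rewrite /Bstable (stable_valueE Blarge); apply: stable_valueE.
have [[m mP] [m' m'P]] := (main, Blarge).
exists (maxn m m') => n; rewrite geq_max => /andP[mn m'n].
by rewrite mP // m'P.
Qed.
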